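(* Let $q$ be a prime power and let $\ell,t$ be positive integers. Let $\mathcal{E}$ be either the type I group (prescribing $\ell$ leading and $t$ ending coefficients) or the type II group (prescribing $\ell$ leading coefficients) of equivalence classes of monic polynomials over $\mathbb{F}_q$, written as an internal direct product of cyclic groups with generators $\xi_1,\dots,\xi_f$ of orders $r_1,\dots,r_f$. Let $\tau=\ell+t-1$ for type I and $\tau=\ell-1$ for type II, and for $\vec j\in\mathcal{J}$ define $$P_{\vec j}(z)=1+\sum_{k=1}^{\tau}c_{k,\vec j}\,z^k .$$ Then, for every $\varepsilon=\xi_1^{t_1}\cdots\xi_f^{t_f}\in\mathcal{E}$, the following hold. (I) For type I, $$\ln F(z)=E\ln\frac{1-z}{1-qz}+\sum_{\vec j\in\mathcal{J}}B_{\vec j}\,\ln P_{\vec j}(z),$$ $$[\varepsilon]\ln F(z)=\frac{1}{q-1}q^{1-\ell-t}\left(\ln\frac{1-z}{1-qz}+\sum_{\vec j\in\mathcal{J}}\prod_{i=1}^f\omega_{r_i}^{-j_it_i}\,\ln P_{\vec j}(z)\right).$$ (II) For type II, $$\ln F(z)=E\ln\frac{1}{1-qz}+\sum_{\vec j\in\mathcal{J}}B_{\vec j}\,\ln P_{\vec j}(z),$$ $$[\varepsilon]\ln F(z)=q^{-\ell}\left(\ln\frac{1}{1-qz}+\sum_{\vec j\in\mathcal{J}}\prod_{i=1}^f\omega_{r_i}^{-j_it_i}\,\ln P_{\vec j}(z)\right).$$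
   Context: $\mathcal{M}$ is the set of monic polynomials over $\mathbb{F}_q$ (including the constant $1$), $\mathcal{M}_d$ those of degree $d$; the reciprocal of $f$ is $\tilde f(x)=x^{\deg f}f(1/x)$. Type I: monic $f,g$ with $f(0)g(0)\neq0$ are equivalent if $\tilde f\equiv\tilde g\pmod{x^{\ell+1}}$ and $f\equiv g\pmod{x^t}$. $\mathcal{E}$ is the set of equivalence classes $\langle f\rangle$ of monic $f$ with $f(0)\ne0$. By convention $\langle f\rangle:=0$ (zero of the group algebra) if $f(0)=0$. Type II: monic $f,g$ are equivalent if $\tilde f\equiv\tilde g\pmod{x^{\ell+1}}$. $\mathcal{E}$ is the set of equivalence classes $\langle f\rangle$ of all monic $f$. In both types $\mathcal{E}$ is a finite abelian group under $\langle f\rangle\langle g\rangle=\langle fg\rangle$ with identity $\langle1\rangle$. The generating function $F(z)=\sum_{f\in\mathcal{M}}\langle f\rangle z^{\deg f}$ is a formal power series with coefficients in the group algebra $\mathbb{C}\mathcal{E}$; $\ln F$ is the formal logarithm, and $[\varepsilon]$ extracts the coefficient (a power series in $z$) of the group element $\varepsilon$. Write $\mathcal{E}$ as an internal direct product of cyclic groups $C_{r_1}\times\cdots\times C_{r_f}$, where $C_{r_i}$ has order $r_i$ and generator $\xi_i$; $\omega_r=\exp(2\pi\sqrt{-1}/r)$. With $[n]=\{1,\dots,n\}$, $\mathcal{R}=[r_1]\times\cdots\times[r_f]$, $\vec r=(r_1,\dots,r_f)$ and $\mathcal{J}=\mathcal{R}\setminus\{\vec r\}$. Define $E=\frac1{|\mathcal{E}|}\sum_{\varepsilon\in\mathcal{E}}\varepsilon$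 and, for $\vec s\in\mathcal{R}$, $$B_{\vec s}=\prod_{i=1}^f J_{r_i,s_i},\qquad J_{r_i,s}=\frac1{r_i}\sum_{j=1}^{r_i}\omega_{r_i}^{-sj}\xi_i^{\,j}\in\mathbb{C}\mathcal{E}.$$ For type I and $1\le d\le\ell+t-1$, $\mathcal{E}_d=\{\langle f\rangle: f\in\mathcal{M}_d,\ f(0)\neq0\}$; for type II and $1\le d\le\ell-1$, $\mathcal{E}_d=\{\langle f\rangle:f\in\mathcal{M}_d\}$. For $\vec j\in\mathcal{R}$, $$c_{d,\vec j}=\sum_{\varepsilon\in\mathcal{E}_d}\ \prod_{i=1}^f\omega_{r_i}^{v_ij_i},\qquad\text{where }\varepsilon=\prod_{i=1}^f\xi_i^{v_i}.$$ *)

(* Defs.v *)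
From HB Require Import structures.
From mathcomp Require Import all_boot all_order all_fingroup all_algebra.
From mathcomp Require Import boolp reals trigo.
From mathcomp Require Import complex.

Set Implicit Arguments.
Unset Strict Implicit.
Unset Printing Implicit Defensive.

Import GroupScope GRing.Theory Num.Theory.
Local Open Scope ring_scope.

Record fps (A : Type) := Fps { fps_coef :> nat -> A }.

Notation "{ 'fps' A }" := (fps A) (format "{ 'fps'  A }") : type_scope.

Lemma fpsP A (f g : {fps A}) : f =1 g <-> f = g.
Proof.
split=> [|-> //]; case: f g => f [g] /= efg.
by congr Fps; apply: functional_extensionality_dep.
Qed.

HB.instance Definition _ (A : Type) := gen_eqMixin {fps A}.
HB.instance Definition _ (A : Type) := gen_choiceMixin {fps A}.

Section FpsZmod.
Variable A : zmodType.
Implicit Types f g : {fps A}.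

Definition fps_zero : {fps A} := Fps (fun=> 0).
Definition fps_opp f : {fps A} := Fps (fun k => - f k).
Definition fps_add f g : {fps A} := Fps (fun k => f k + g k).

Fact fps_addA : associative fps_add.
Proof. by move=> f g h; apply/fpsP => k /=; rewrite addrA. Qed.
Fact fps_addC : commutative fps_add.
Proof. by move=> f g; apply/fpsP => k /=; rewrite addrC. Qed.
Fact fps_add0 : left_id fps_zero fps_add.
Proof. by move=> f; apply/fpsP => k /=; rewrite add0r. Qed.
Fact fps_addN : left_inverse fps_zero fps_opp fps_add.
Proof. by move=> f; apply/fpsP => k /=; rewrite addNr. Qed.

HB.instance Definition _ :=
  GRing.isZmodule.Build {fps A} fps_addA fps_addC fps_add0 fps_addN.

Lemma fpsD f g k : (f + g) k = f k + g k. Proof. by []. Qed.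
Lemma fpsN f k : (- f) k = - f k. Proof. by []. Qed.
Lemma fps0 k : (0 : {fps A}) k = 0. Proof. by []. Qed.
Lemma fpsB f g k : (f - g) k = f k - g k. Proof. by []. Qed.

Lemma fps_sum I (s : seq I) (P : pred I) (f : I -> {fps A}) k :
  (\sum_(i <- s | P i) f i) k = \sum_(i <- s | P i) f i k.
Proof. exact: (big_morph (fun f : {fps A} => f k) (id1 := 0)). Qed.

End FpsZmod.

Section FpsRing.
Variable A : nzRingType.
Implicit Types f g h : {fps A}.

Definition fps_one : {fps A} := Fps (fun k => (k == 0%N)%:R).
Definition fps_mul f g : {fps A} :=
  Fps (fun k => \sum_(i < k.+1) f i * g (k - i)%N).

Definition fps_trunc n f : {poly A} := \poly_(i < n) f i.

Lemma coef_trunc n f k : (k < n)%N -> (fps_trunc n f)`_k = f k.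
Proof. by rewrite coef_poly => ->. Qed.

Lemma fps_mul_trunc n f g k : (k < n)%N ->
  fps_mul f g k = (fps_trunc n f * fps_trunc n g)`_k.
Proof.
move=> ltkn; rewrite coefM; apply: eq_bigr => i _.
rewrite !coef_trunc // ?(leq_ltn_trans (leq_subr _ _)) //.
by rewrite (leq_ltn_trans _ ltkn) // -ltnS.
Qed.

Fact fps_mulA : associative fps_mul.
Proof.
move=> f g h; apply/fpsP => k.
pose T := fps_trunc k.+1.
transitivity (T f * (T g * T h))`_k; last rewrite mulrA; last symmetry.
  rewrite coefM; apply: eq_bigr => i _; rewrite coef_trunc //.
  by rewrite (@fps_mul_trunc k.+1) // ltnS leq_subr.
rewrite coefM; apply: eq_bigr => i _; rewrite coef_trunc ?ltnS ?leq_subr //.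
by rewrite (@fps_mul_trunc k.+1).
Qed.

Fact fps_mul1 : left_id fps_one fps_mul.
Proof.
move=> f; apply/fpsP => k /=; rewrite big_ord_recl /= mul1r subn0 big1 ?addr0 //.
by move=> i _; rewrite mul0r.
Qed.

Fact fps_mulr1 : right_id fps_one fps_mul.
Proof.
move=> f; apply/fpsP => k /=; rewrite big_ord_recr /= subnn mulr1.
rewrite big1 ?add0r // => i _.
by rewrite subn_eq0 leqNgt ltn_ord mulr0.
Qed.

Fact fps_mulDl : left_distributive fps_mul +%R.
Proof.
move=> f g h; apply/fpsP => k; rewrite fpsD /= -big_split /=.
by apply: eq_bigr => i _; rewrite mulrDl.
Qed.

Fact fps_mulDr : right_distributive fps_mul +%R.
Proof.
move=> f g h; apply/fpsP => k; rewrite fpsD /= -big_split /=.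
by apply: eq_bigr => i _; rewrite mulrDr.
Qed.

Fact fps_one_neq0 : fps_one != 0.
Proof. by apply/eqP => /fpsP /(_ 0%N) /eqP; rewrite oner_eq0. Qed.

HB.instance Definition _ := GRing.Zmodule_isNzRing.Build {fps A}
  fps_mulA fps_mul1 fps_mulr1 fps_mulDl fps_mulDr fps_one_neq0.

Lemma fpsM f g k : (f * g) k = \sum_(i < k.+1) f i * g (k - i)%N.
Proof. by []. Qed.
Lemma fps1 k : (1 : {fps A}) k = (k == 0%N)%:R. Proof. by []. Qed.

Definition fpsX : {fps A} := Fps (fun k => (k == 1%N)%:R).

Lemma fps_exp_eq0 f n k : f 0%N = 0 -> (k < n)%N -> (f ^+ n) k = 0.
Proof.
move=> f0; elim: n k => // n IHn k ltkn; rewrite exprS fpsM big1 // => -[[|i] lti] _.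
  by rewrite f0 mul0r.
rewrite /= IHn ?mulr0 //; move: lti ltkn; rewrite !ltnS; case: k => // k lti ltkn.
by rewrite subSS (leq_ltn_trans (leq_subr _ _)).
Qed.

End FpsRing.
Arguments fpsX {A}.

Fact fps_mulC (A : comNzRingType) : commutative (@fps_mul A).
Proof.
move=> f g; apply/fpsP => k.
by rewrite !(@fps_mul_trunc _ k.+1) // mulrC.
Qed.

HB.instance Definition _ (A : comNzRingType) :=
  GRing.PzRing_hasCommutativeMul.Build {fps A} (@fps_mulC A).

Section FpsUnit.
Variable A : comUnitRingType.
Implicit Types f g : {fps A}.

Definition fps_const (a : A) : {fps A} := Fps (fun k => a *+ (k == 0%N)).

Lemma fps_constM a f k : (fps_const a * f) k = a * f k.
Proof.
rewrite fpsM big_ord_recl /= subn0 big1 ?addr0 // => i _.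
by rewrite mulr0n mul0r.
Qed.

Definition fps_unit : {pred {fps A}} := fun f => f 0%N \is a GRing.unit.

(* Geometric series: f^-1 = a^-1 (1 + u + u^2 + ...) with a = f(0) and
   u = 1 - a^-1 f; since u(0) = 0, u^n does not contribute to the coefficient
   of z^k when n > k. *)
Definition fps_inv f : {fps A} :=
  if f \in fps_unit then
    Fps (fun k => (f 0%N)^-1 *
      \sum_(n < k.+1) ((1 - fps_const (f 0%N)^-1 * f) ^+ n) k)
  else f.

Fact fps_mulV : {in fps_unit, left_inverse 1 fps_inv *%R}.
Proof.
move=> f uf; rewrite /fps_inv uf; set a := f 0%N; set u := 1 - _.
have u0 : u 0%N = 0 by rewrite fpsB fps_constM mulVr // subrr.
have E : f = fps_const a * (1 - u).
  apply/fpsP => k; rewrite fps_constM fpsB opprB addrC subrK.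
  by rewrite fps_constM mulVKr.
apply/fpsP => k; set g := Fps _.
pose g' := fps_const a^-1 * \sum_(n < k.+1) u ^+ n.
have gE i : (i <= k)%N -> g i = g' i.
  move=> leik; rewrite /g' fps_constM fps_sum; congr (_ * _).
  rewrite /= (big_ord_widen_cond k.+1 xpredT (fun n => (u ^+ n) i)) //.
  rewrite big_mkcond; apply: eq_bigr => n _; case: ltnP => // ltin.
  by rewrite fps_exp_eq0.
have -> : (g * f) k = (g' * f) k.
  by rewrite !fpsM; apply: eq_bigr => i _; rewrite (gE i _) ?leq_ord.
have -> : g' * f = 1 - u ^+ k.+1.
  rewrite [X in _ * X = _]E mulrACA.
  have -> : fps_const a^-1 * fps_const a = 1.
    by apply/fpsP => i; rewrite fps_constM fps1 mulrnAr mulVr.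
  by rewrite mul1r mulrC -opprB mulNr -subrX1 opprB.
by rewrite fpsB fps_exp_eq0 ?subr0.
Qed.

Fact fps_unitPl f g : g * f = 1 -> fps_unit f.
Proof.
move/fpsP/(_ 0%N); rewrite fpsM big_ord1 fps1 /= => gf1.
by apply/unitrP; exists (g 0%N); rewrite gf1 mulrC gf1.
Qed.

Fact fps_inv_out : {in [predC fps_unit], fps_inv =1 id}.
Proof. by move=> f /negbTE nuf; rewrite /fps_inv nuf. Qed.

HB.instance Definition _ := GRing.ComNzRing_hasMulInverse.Build {fps A}
  fps_mulV fps_unitPl fps_inv_out.

End FpsUnit.

Section FpsLmod.
Variables (K : pzRingType) (V : lmodType K).

Definition fps_scale (c : K) (f : {fps V}) : {fps V} := Fps (fun k => c *: f k).

Fact fps_scaleA a b f : fps_scale a (fps_scale b f) = fps_scale (a * b) f.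
Proof. by apply/fpsP => k /=; rewrite scalerA. Qed.
Fact fps_scale1 : left_id 1 fps_scale.
Proof. by move=> f; apply/fpsP => k /=; rewrite scale1r. Qed.
Fact fps_scaleDr : right_distributive fps_scale +%R.
Proof. by move=> a f g; apply/fpsP => k /=; rewrite scalerDr. Qed.
Fact fps_scaleDl f : {morph fps_scale^~ f : a b / a + b}.
Proof. by move=> a b; apply/fpsP => k /=; rewrite scalerDl. Qed.

HB.instance Definition _ := GRing.Zmodule_isLmodule.Build K {fps V}
  fps_scaleA fps_scale1 fps_scaleDr fps_scaleDl.

Lemma fpsZ c (f : {fps V}) k : (c *: f) k = c *: f k. Proof. by []. Qed.

(* a s(z), for a vector a and a scalar series s *)
Definition fps_vec (a : V) (s : {fps K^o}) : {fps V} := Fps (fun k => (s k : K) *: a).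

End FpsLmod.

Section FpsLn.
Variables (K : fieldType) (A : lalgType K).

(* ln f = sum_(n >= 1) (-1)^(n-1)/n (f - 1)^n, meaningful when f(0) = 1 and K
   has characteristic 0; (f - 1)^n does not contribute to the coefficient of
   z^k when n > k. *)
Definition fps_ln (f : {fps A}) : {fps A} :=
  Fps (fun k => \sum_(1 <= n < k.+1) ((-1) ^+ n.-1 / n%:R : K) *: ((f - 1) ^+ n) k).

Lemma fps_lnE (f : {fps A}) N k : f 0%N = 1 -> (k < N)%N ->
  fps_ln f k =
  (\sum_(1 <= n < N) ((-1) ^+ n.-1 / n%:R : K) *: (f - 1) ^+ n) k.
Proof.
move=> f0 ltkN; rewrite fps_sum (big_cat_nat (n := k.+1) (p := N)) //=.
rewrite -[LHS]addr0; congr (_ + _); rewrite big_nat big1 // => n /andP[ltkn _].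
by rewrite fps_exp_eq0 ?scaler0 // fpsB f0 fps1 subrr.
Qed.

End FpsLn.

Definition galg (K : Type) (gT : finType) := {ffun gT -> K}.

HB.instance Definition _ (K : choiceType) (gT : finType) :=
  Choice.on (galg K gT).
HB.instance Definition _ (K : zmodType) (gT : finType) :=
  GRing.Zmodule.on (galg K gT).

Section GroupAlgebra.
Variables (K : nzRingType) (gT : finGroupType).
Local Notation galg := (galg K gT).
Implicit Types a b c : galg.

Definition galg_in (g : gT) : galg := [ffun h => (h == g)%:R].

Definition galg_mul a b : galg :=
  [ffun g => \sum_h a h * b (h^-1 * g)%g].

Fact galg_mulA : associative galg_mul.
Proof.
move=> a b c; apply/ffunP => g; rewrite !ffunE.
under [RHS]eq_bigr do rewrite ffunE mulr_suml.
rewrite exchange_big /=; apply: eq_bigr => k _; rewrite ffunE mulr_sumr.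
rewrite (reindex_inj (mulgI k^-1%g)) /=; apply: eq_bigr => h _.
by rewrite mulrA invMg invgK !mulgA mulgK.
Qed.

Fact galg_mul1 : left_id (galg_in 1%g) galg_mul.
Proof.
move=> a; apply/ffunP => g; rewrite ffunE (bigD1 1%g) //= ffunE eqxx mul1r.
rewrite invg1 mul1g big1 ?addr0 // => h /negbTE nh1.
by rewrite ffunE nh1 mul0r.
Qed.

Fact galg_mulr1 : right_id (galg_in 1%g) galg_mul.
Proof.
move=> a; apply/ffunP => g; rewrite ffunE (bigD1 g) //= ffunE mulVg eqxx mulr1.
rewrite big1 ?addr0 // => h nhg; rewrite ffunE -eq_mulVg1 (negbTE nhg) mulr0 //.
Qed.

Fact galg_mulDl : left_distributive galg_mul +%R.
Proof.
move=> a b c; apply/ffunP => g; rewrite !ffunE -big_split /=.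
by apply: eq_bigr => h _; rewrite ffunE mulrDl.
Qed.

Fact galg_mulDr : right_distributive galg_mul +%R.
Proof.
move=> a b c; apply/ffunP => g; rewrite !ffunE -big_split /=.
by apply: eq_bigr => h _; rewrite ffunE mulrDr.
Qed.

Fact galg_one_neq0 : galg_in 1%g != 0.
Proof. by apply/eqP => /ffunP /(_ 1%g) /eqP; rewrite !ffunE eqxx oner_eq0. Qed.

HB.instance Definition _ := GRing.Zmodule_isNzRing.Build galg
  galg_mulA galg_mul1 galg_mulr1 galg_mulDl galg_mulDr galg_one_neq0.

HB.instance Definition _ := GRing.Lmodule.copy galg {ffun gT -> K^o}.

Fact galg_scaleAl (k : K) a b : k *: (a * b) = (k *: a) * b.
Proof.
apply/ffunP => g; rewrite !ffunE /GRing.scale /= mulr_sumr.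
by apply: eq_bigr => h _; rewrite !ffunE mulrA.
Qed.

HB.instance Definition _ :=
  GRing.Lmodule_isLalgebra.Build K galg galg_scaleAl.

Lemma galg_inM g h : galg_in (g * h)%g = galg_in g * galg_in h.
Proof.
apply/ffunP => k; rewrite !ffunE (bigD1 g) //= !ffunE eqxx mul1r big1 => [|i ni].
  by rewrite addr0 (can2_eq (mulKVg _) (mulKg _)).
by rewrite ffunE (negbTE ni) mul0r.
Qed.

(* [eps] f, a scalar power series *)
Definition fps_extract (eps : gT) (f : {fps galg}) : {fps K^o} :=
  Fps (fun k => f k eps).

End GroupAlgebra.
Arguments galg_in {K gT} g.

Section Reciprocal.
Variable F : idomainType.
Implicit Types f g : {poly F}.

(* x^(deg f) f(1/x) *)
Definition recip f : {poly F} :=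
  \sum_(i < size f) f`_i *: 'X^((size f).-1 - i).

Definition revn n f : {poly F} := \sum_(i < n.+1) f`_i *: 'X^(n - i).

Lemma revnD n f g : revn n (f + g) = revn n f + revn n g.
Proof.
rewrite -big_split; apply: eq_bigr => i _ /=.
by rewrite coefD scalerDl.
Qed.

Lemma revnZ n c f : revn n (c *: f) = c *: revn n f.
Proof. by rewrite scaler_sumr; apply: eq_bigr => i _; rewrite coefZ scalerA. Qed.

Lemma revnXn n i : (i <= n)%N -> revn n 'X^i = 'X^(n - i).
Proof.
move=> lein; have ltin : (i < n.+1)%N by [].
rewrite /revn (bigD1 (Ordinal ltin)) //= coefXn eqxx scale1r big1 ?addr0 //.
by move=> j nji; rewrite coefXn -[_ == i]/(j == Ordinal ltin) (negbTE nji) scale0r.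
Qed.

Lemma revn_sum n I (s : seq I) (P : I -> {poly F}) :
  revn n (\sum_(i <- s) P i) = \sum_(i <- s) revn n (P i).
Proof.
apply: (big_morph (revn n) (revnD n)).
by rewrite /revn big1 // => i _; rewrite coef0 scale0r.
Qed.

Lemma recip_revn f : f != 0 -> recip f = revn (size f).-1 f.
Proof. by move=> nz_f; rewrite /recip /revn prednK // size_poly_gt0. Qed.

Lemma recipM f g : f != 0 -> g != 0 -> recip (f * g) = recip f * recip g.
Proof.
move=> nz_f nz_g; rewrite recip_revn ?mulf_neq0 // size_mul //.
set m := (size f).-1; set n := (size g).-1.
have Df : size f = m.+1 by rewrite prednK // size_poly_gt0.
have Dg : size g = n.+1 by rewrite prednK // size_poly_gt0.
rewrite Df Dg addSn addnS /= -{1}[f]coefK -{1}[g]coefK !poly_def Df Dg.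
rewrite big_distrlr revn_sum /recip Df Dg big_distrlr /=.
apply: eq_bigr => i _; rewrite revn_sum; apply: eq_bigr => j _.
have lei : (i <= m)%N by rewrite -ltnS.
have lej : (j <= n)%N by rewrite -ltnS.
rewrite -!scalerAl -!scalerAr !revnZ -!exprD revnXn ?leq_add //.
by rewrite subnDA [(m + n)%N]addnC -addnBA // addnC addnBA.
Qed.

Lemma recip1 : recip 1 = 1.
Proof. by rewrite /recip size_poly1 big_ord1 coef1 eqxx scale1r. Qed.

Lemma recip_at0 f : f != 0 -> (recip f).[0] = lead_coef f.
Proof.
move=> nz_f; have Df : size f = (size f).-1.+1.
  by rewrite prednK // size_poly_gt0.
rewrite horner_sum Df big_ord_recr /= subnn hornerZ hornerXn expr0 mulr1.
rewrite big1 ?add0r // => i _; rewrite hornerZ hornerXn expr0n subn_eq0.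
by rewrite leqNgt ltn_ord mulr0.
Qed.

End Reciprocal.

(* Both kinds prescribe l leading coefficients; TypeI t also prescribes t ending
   coefficients and restricts to polynomials not vanishing at 0. *)
Variant kind := TypeI of nat | TypeII.

Local Open Scope quotient_scope.

Section Classes.
Variables (F : finFieldType) (l : nat) (k : kind).
Implicit Types f g : {poly F}.

Definition admissible f : bool :=
  (f \is monic) && (if k is TypeI _ then f.[0] != 0 else true).

Definition adm_poly := {f : {poly F} | admissible f}.

Definition class_rel : rel adm_poly := fun u v =>
  ('X^(l.+1) %| recip (val u) - recip (val v)) &&
  (if k is TypeI t then 'X^t %| val u - val v else true).

Lemma dvdp_subxx (d f : {poly F}) : d %| f - f. Proof. by rewrite subrr dvdp0. Qed.
Lemma dvdp_subC (d f g : {poly F}) : (d %| f - g) = (d %| g - f).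
Proof. by rewrite -opprB dvdpNr. Qed.
Lemma dvdp_sub_trans (d f g h : {poly F}) : d %| g - f -> d %| f - h -> d %| g - h.
Proof. by move=> dgf dfh; rewrite -(subrKA f) dvdp_add. Qed.

Fact class_rel_refl : reflexive class_rel.
Proof. by move=> f; rewrite /class_rel dvdp_subxx; case: k => *; rewrite ?dvdp_subxx. Qed.
Fact class_rel_sym : symmetric class_rel.
Proof.
move=> f g; rewrite /class_rel dvdp_subC; case: k => // t.
by rewrite [in X in _ && X]dvdp_subC.
Qed.
Fact class_rel_trans : transitive class_rel.
Proof.
move=> f g h /andP[gf1 gf2] /andP[fh1 fh2]; rewrite /class_rel (dvdp_sub_trans gf1 fh1).
by case: k gf2 fh2 => //= t; apply: dvdp_sub_trans.
Qed.

Canonical class_equiv :=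
  EquivRel class_rel class_rel_refl class_rel_sym class_rel_trans.

Definition pclass := {eq_quot class_equiv}%qT.

HB.instance Definition _ := Choice.on pclass.
HB.instance Definition _ := EqQuotient.on pclass.

Definition adm_class (u : adm_poly) : pclass := \pi_(pclass) u.

Lemma adm_classP (f g : adm_poly) : reflect (adm_class f = adm_class g) (class_rel f g).
Proof. exact: (eqmodP class_equiv). Qed.

(* The class of f is determined by the remainders of recip f and f. *)
Definition tail_len := if k is TypeI t then t else 0%N.
Definition class_sig_type : finType := ({poly_(l.+1) F} * {poly_tail_len F})%type.
Definition class_sig (e : pclass) : class_sig_type :=
  let f := val (generic_quotient.repr e) in
  (npolyp l.+1 (recip f %% 'X^(l.+1)), npolyp tail_len (f %% 'X^tail_len)).

Lemma modXn_eq n f g :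
  npolyp n (f %% 'X^n) = npolyp n (g %% 'X^n) -> 'X^n %| f - g.
Proof.
have szX (h : {poly F}) : (size (h %% 'X^n)%R <= n)%N.
  by have := ltn_modp h 'X^n; rewrite -size_poly_gt0 size_polyXn ltnS.
move/(congr1 val); rewrite /= !npolypK ?qualifE //= ?szX //.
by rewrite /dvdp modpD modpN => ->; rewrite subrr.
Qed.

Lemma class_sig_inj : injective class_sig.
Proof.
move=> e1 e2 [/modXn_eq E1 /modXn_eq E2].
rewrite -[e1]reprK -[e2]reprK; apply/adm_classP; rewrite /class_rel E1.
by move: E2; rewrite /tail_len; case: k.
Qed.

Definition class_unsig (s : class_sig_type) : option pclass :=
  if pselect (exists e, class_sig e == s) is left ex then Some (xchoose ex) else None.

Lemma class_sigK : pcancel class_sig class_unsig.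
Proof.
move=> e; rewrite /class_unsig; case: pselect => [ex|[]]; last by exists e.
by congr Some; apply: class_sig_inj; apply/eqP/(xchooseP ex).
Qed.

HB.instance Definition _ := PCanIsCountable class_sigK.
HB.instance Definition _ : isFinite pclass := PCanIsFinite class_sigK.

Fact admissible1 : admissible 1.
Proof. by rewrite /admissible monic1; case: k => // t; rewrite hornerC oner_eq0. Qed.

Fact admissibleM f g : admissible f -> admissible g -> admissible (f * g).
Proof.
rewrite /admissible => /andP[mf f0] /andP[mg g0]; rewrite rpredM //=.
by case: k f0 g0 => // t f0 g0; rewrite hornerM mulf_neq0.
Qed.

Definition adm1 : adm_poly := exist _ 1 admissible1.
Definition admM (f g : adm_poly) : adm_poly :=
  exist _ (val f * val g) (admissibleM (valP f) (valP g)).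

Lemma adm_neq0 (f : adm_poly) : val f != 0.
Proof. by case: f => f /= /andP[/monic_neq0]. Qed.

Lemma class_relMr (f g h : adm_poly) :
  class_rel (admM f h) (admM g h) = class_rel f g.
Proof.
have mh : (recip (val h)).[0] != 0.
  by rewrite recip_at0 ?adm_neq0 // lead_coef_eq0 adm_neq0.
have coX n (p : {poly F}) : p.[0] != 0 -> coprimep 'X^n p.
  by move=> p0; rewrite coprimep_expl // coprimep_sym coprimepX.
rewrite /class_rel /= !recipM ?adm_neq0 // -!mulrBl Gauss_dvdpl ?coX //.
congr (_ && _); case/andP: (valP h) => _.
rewrite -[sval h]/(val h); move: (val f) (val g) (val h) => p q r.
by case: k => // t r0; rewrite Gauss_dvdpl ?coX.
Qed.

Definition class_mul (e1 e2 : pclass) : pclass :=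
  adm_class (admM (generic_quotient.repr e1) (generic_quotient.repr e2)).
Definition class_one : pclass := adm_class adm1.

Lemma admMC (f g : adm_poly) : admM f g = admM g f.
Proof. by apply: val_inj; rewrite /= mulrC. Qed.

Lemma class_mulE (f g : adm_poly) :
  class_mul (adm_class f) (adm_class g) = adm_class (admM f g).
Proof.
apply/adm_classP; apply: (@class_rel_trans (admM f (generic_quotient.repr (adm_class g)))).
  by rewrite class_relMr; apply/adm_classP; rewrite /adm_class reprK.
by rewrite ![admM f _]admMC class_relMr; apply/adm_classP; rewrite /adm_class reprK.
Qed.

Lemma pclassW (P : pclass -> Prop) : (forall u, P (adm_class u)) -> forall e, P e.
Proof. by move=> Pf e; rewrite -[e]reprK; apply: Pf. Qed.

Fact class_mulA : associative class_mul.
Proof.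
elim/pclassW => f; elim/pclassW => g; elim/pclassW => h; rewrite !class_mulE.
by congr adm_class; apply: val_inj; rewrite /= mulrA.
Qed.

Fact class_mul1 : left_id class_one class_mul.
Proof.
elim/pclassW => f; rewrite class_mulE.
by congr adm_class; apply: val_inj; rewrite /= mul1r.
Qed.

Fact class_mulI e : injective (class_mul^~ e).
Proof.
elim/pclassW: e => h; elim/pclassW => f; elim/pclassW => g; rewrite !class_mulE.
by move/adm_classP; rewrite class_relMr => /adm_classP.
Qed.

Definition class_inv (e : pclass) : pclass := invF (@class_mulI e) class_one.

Fact class_mulV : left_inverse class_one class_inv class_mul.
Proof. by move=> e; apply: (f_invF (@class_mulI e)). Qed.

HB.instance Definition _ :=
  Finite_isGroup.Build pclass class_mulA class_mul1 class_mulV.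

Lemma adm_classM (f g : adm_poly) : adm_class (admM f g) = (adm_class f * adm_class g)%g.
Proof. by rewrite -class_mulE. Qed.

(* <f>; None when f is not admissible, standing for the convention <f> := 0 *)
Definition poly_class f : option pclass := omap adm_class (insub f).

(* The set M_d; {poly_d.+1 F} is the finite type of polynomials of degree <= d. *)
Definition monics d : {set {poly_d.+1 F}} :=
  [set f : {poly_d.+1 F} | ((f : {poly F}) \is monic) && (size f == d.+1)].

(* E_d *)
Definition class_set d : {set pclass} :=
  [set e | [exists f in monics d, poly_class (val f) == Some e]].

Definition tau : nat := if k is TypeI t then (l + t - 1)%N else (l - 1)%N.

End Classes.

Section Characters.
Variables (R : realType) (gT : finGroupType) (n : nat) (xi : 'I_n -> gT).
Local Notation C := R[i].

(* exp (2 pi sqrt(-1) / r) *)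
Definition omega (r : nat) : C :=
  Complex (cos (2 * pi / r%:R)) (sin (2 * pi / r%:R)).

(* Vectors of naturals with entries bounded so that R fits in a finite type; an
   entry j i is the actual integer in [r_i], not its predecessor. *)
Definition multi := {ffun 'I_n -> 'I_(\max_(i < n) #[xi i]).+1}.

Definition Rset : {set multi} := [set j : multi | [forall i, 0 < j i <= #[xi i]]%N].
Definition Jset : {set multi} :=
  [set j in Rset | [exists i, (j i : nat) != #[xi i]]].

(* The v in R with e = prod_i xi_i^(v_i), unique when the group is the direct
   product of the <[xi i]>; the default value is irrelevant then. *)
Definition exponents (e : gT) : multi :=
  odflt [ffun=> ord0] [pick v in Rset | e == \prod_i xi i ^+ v i]%g.

(* J_(r_i, s) *)
Definition Javg (i : 'I_n) (s : nat) : galg C gT :=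
  (#[xi i]%:R : C)^-1 *:
    \sum_(1 <= j < #[xi i].+1)
       (omega #[xi i] ^- (s * j)) *: (galg_in (xi i ^+ j)%g : galg C gT).

(* B_s *)
Definition Bidem (s : multi) : galg C gT := \prod_i Javg i (s i).

Definition avgE : galg C gT :=
  (#|gT|%:R : C)^-1 *: \sum_(e : gT) (galg_in e : galg C gT).

(* c_(d, j), for S = E_d *)
Definition char_sum (S : {set gT}) (j : multi) : C :=
  \sum_(e in S) \prod_i omega #[xi i] ^+ (exponents e i * j i).

End Characters.

Section Series.
Variables (R : realType) (F : finFieldType) (l : nat) (k : kind).
Local Notation C := R[i].
Local Notation E := (pclass F l k).

Definition poly_galg (f : {poly F}) : galg C E :=
  if poly_class l k f is Some e then galg_in e else 0.

Definition genF : {fps galg C E} :=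
  Fps (fun d => \sum_(f in monics F d) poly_galg (val f)).

Definition Pseries n (xi : 'I_n -> E) (j : multi xi) : {fps C^o} :=
  1 + \sum_(1 <= d < (tau l k).+1)
        char_sum R (class_set F l k d) j *: fpsX ^+ d.

End Series.

(* Main.v *)
(* For j in R let chi_j be the character of the class group E with
   chi_j(xi_i) = omega_(r_i)^(j_i). The elements B_j sum to 1 and satisfy
   e B_j = chi_j(e) B_j for every e in E, so F B_j = chi_j(F) B_j, where chi_j(F)
   is a scalar series, and hence ln F = sum_j B_j ln (chi_j(F)).

   Two monic polynomials of the same degree d are equivalent iff they agree on the
   top l + 1 and on the bottom t coefficients (t = 0 for type II). So distinct ones
   are inequivalent when d <= l + t, while for d >= l + t each class contains the
   same number of them, as its polynomials of degree d form a coset of a fixed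
   subgroup. In the latter range the coefficient of z^d in F is a multiple of the
   sum of all classes, which is killed by every B_j with chi_j nontrivial: then
   chi_j(F) = P_j. For trivial chi_j, B_j is the average of all classes, and
   chi_j(F) counts the admissible polynomials by degree. *)

Require Import Defs.
From mathcomp Require Import all_boot all_order all_fingroup all_algebra.
From mathcomp Require Import boolp reals trigo.
From mathcomp Require Import cyclic complex.

Set Implicit Arguments.
Unset Strict Implicit.
Unset Printing Implicit Defensive.

Import Order.TTheory GRing.Theory Num.Theory.
Local Open Scope ring_scope.

(** * Roots of unity and their power sums *)

Section RootsOfUnity.
Variable R : realType.

Lemma omegaX r k : omega R r ^+ k =
  Complex (cos (k%:R * (2 * pi / r%:R))) (sin (k%:R * (2 * pi / r%:R))).
Proof.
elim: k => [|k IHk]; first by rewrite mul0r cos0 sin0.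
rewrite exprSr IHk /omega; set x := 2 * pi / r%:R.
rewrite -natr1 mulrDl mul1r cosD sinD /GRing.mul /=.
by congr Complex; rewrite addrC; congr (_ + _); rewrite mulrC.
Qed.

(** Put x = (i + 1) pi / r. If the power i + 1 < r were 1, then 1 = cos (2 x) = 1 - 2 (sin x)^2,
    whereas sin is positive on ]0, pi[. *)
Lemma omega_prim r : (0 < r)%N -> r.-primitive_root (omega R r).
Proof.
move=> r_gt0; have r0 : (r%:R : R) != 0 by rewrite pnatr_eq0 -lt0n.
apply/andP; split=> //; apply/forallP => -[i ltir] /=.
rewrite unity_rootE omegaX.
set x := i.+1%:R * (pi / r%:R : R).
have -> : i.+1%:R * (2 * pi / r%:R) = x *+ 2 :> R.
  by rewrite -(mulr_natl x 2) /x [RHS]mulrCA; congr (_ * _); rewrite mulrA.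
have [eir|neir] := eqVneq i.+1 r.
  have -> : x = pi by rewrite /x eir mulrCA divff ?mulr1.
  by rewrite cos2pi sin2pi; apply/eqP/eqP.
rewrite eqbF_neg; apply/eqP => -[cos1 _].
move: cos1; rewrite cos_mulr2n cos2sin2 mulrnBl addrAC => /eqP.
have -> : 1 *+ 2 - 1 = 1 :> R by rewrite mulr2n addrK.
have sx : 0 < sin x.
  apply: sin_gt0_pi; rewrite /x mulr_gt0 ?divr_gt0 ?pi_gt0 ?ltr0n //=.
  rewrite mulrCA gtr_pMr ?pi_gt0 // ltr_pdivrMr ?ltr0n // mul1r ltr_nat.
  by rewrite ltn_neqAle neir.
by rewrite -subr_eq0 addrAC subrr sub0r oppr_eq0 mulrn_eq0 expf_eq0 /= gt_eqF.
Qed.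

Lemma omega_neq0 r : (0 < r)%N -> omega R r != 0.
Proof.
move=> r_gt0; apply/eqP => w0.
have /eqP := prim_expr_order (omega_prim r_gt0).
by rewrite w0 expr0n gtn_eqF // eq_sym oner_eq0.
Qed.

(** A geometric sum with ratio z = omega^(-v): since z^r = 1, the factor z - 1 annihilates it, and z
    = 1 exactly when r divides v. *)
Lemma sum_omegaV r v : (0 < r)%N ->
  \sum_(1 <= s < r.+1) omega R r ^- (s * v) = if (r %| v)%N then r%:R else 0.
Proof.
move=> r_gt0; have w := omega_prim r_gt0.
pose z := omega R r ^- v.
transitivity (z * \sum_(i < r) z ^+ i).
  rewrite big_add1 /= big_mkord mulr_sumr; apply: eq_bigr => i _.
  by rewrite -exprS /z exprVn -exprM mulnC.
have zr : z ^+ r = 1 by rewrite /z exprVn -exprM mulnC exprM (prim_expr_order w) expr1n invr1.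
case: ifP => [|ndv].
  rewrite (prim_order_dvd w) => /eqP wv.
  have -> : z = 1 by rewrite /z wv invr1.
  by rewrite mul1r; under eq_bigr do rewrite expr1n; rewrite sumr_const card_ord.
apply/eqP; rewrite mulf_eq0; apply/orP; right.
have /eqP : (z - 1) * \sum_(i < r) z ^+ i = 0 by rewrite -subrX1 zr subrr.
rewrite mulf_eq0 subr_eq0 => /orP[|//].
by rewrite /z invr_eq1 -(prim_order_dvd w) ndv.
Qed.

End RootsOfUnity.

Lemma galg_scaleAr (K : comNzRingType) (gT : finGroupType) (c : K) (a b : galg K gT) :
  a * (c *: b) = c *: (a * b).
Proof.
apply/ffunP => g; rewrite !ffunE /GRing.scale /= mulr_sumr; apply: eq_bigr => h _.
by rewrite !ffunE /GRing.scale /= mulrCA.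
Qed.

(** * The idempotents of the group algebra of an abelian group *)

Section Idempotents.
Variables (R : realType) (gT : finGroupType) (n : nat) (xi : 'I_n -> gT).
Local Notation C := R[i].
Hypothesis abG : forall x y : gT, commute x y.
Hypothesis dxi : (\big[dprod/1]_(i < n) <[xi i]> = [set: gT])%g.

(** Distributivity. The ranges 1..r_i are first widened to one common range with a side condition,
    since all entries of a [multi] share a codomain. *)
Lemma sum_Rset (A : nzRingType) (G : 'I_n -> nat -> A) :
  \prod_i \sum_(1 <= s < #[xi i]%g.+1) G i s =
  \sum_(j in Rset xi) \prod_i G i (j i).
Proof.
set M := (\max_(i < n) #[xi i]%g)%N.
transitivity (\prod_i \sum_(s < M.+1 | (0 < s <= #[xi i]%g)%N) G i s).
  apply: eq_bigr => i _.
  rewrite (big_nat_widen _ _ M.+1) ?ltnS; last by rewrite (leq_bigmax i).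
  by rewrite (big_nat_widenl _ 0%N) // big_mkord; apply: eq_bigl => s; rewrite ltnS andbC.
rewrite bigA_distr_big_dep; apply: eq_bigl => j.
rewrite [RHS]inE; apply/familyP/forallP => fj i; exact: fj.
Qed.

Lemma prod_expgD (v w : 'I_n -> nat) :
  (\prod_i xi i ^+ (v i + w i) = \prod_i xi i ^+ v i * \prod_i xi i ^+ w i)%g.
Proof.
elim: (index_enum _) => [|i s IHs]; first by rewrite !big_nil mulg1.
rewrite !big_cons IHs expgD !mulgA; congr (_ * _)%g.
by rewrite -!mulgA; congr (_ * _)%g; apply: abG.
Qed.

(** Components in an internal direct product are unique, and powers of [xi i] agree exactly when
    their exponents are congruent modulo its order. *)
Lemma prod_expg_inj (v w : 'I_n -> nat) :
  (\prod_i xi i ^+ v i = \prod_i xi i ^+ w i)%g ->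
  forall i, (v i = w i %[mod #[xi i]%g])%N.
Proof.
move=> evw i; have [c [_ _ c_uniq]] := mem_bigdprod (G := [group of setT]) dxi
  (in_setT (\prod_i xi i ^+ v i)%g).
apply/eqP; rewrite -eq_expg_mod_order.
by rewrite (c_uniq (fun i => xi i ^+ v i)%g) ?(c_uniq (fun i => xi i ^+ w i)%g) // => *;
  rewrite mem_cycle.
Qed.

Lemma exponentsP (e : gT) :
  exponents xi e \in Rset xi /\ (e = \prod_i xi i ^+ exponents xi e i)%g.
Proof.
rewrite /exponents; case: pickP => [v /andP[Rv /eqP ev] //|noexp].
have [c [c_in ec _]] := mem_bigdprod (G := [group of setT]) dxi (in_setT e).
have c_exp i : exists k : 'I_(\max_(i < n) #[xi i]%g).+1,
    (0 < k <= #[xi i]%g)%N && (c i == xi i ^+ k)%g.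
  have /cyclePmin[m ltm cm] := c_in i isT.
  have lt_max k : (k <= #[xi i]%g)%N -> (k < (\max_(i < n) #[xi i]%g).+1)%N.
    by move=> lek; rewrite ltnS (leq_trans lek) // (leq_bigmax i).
  (* [cyclePmin] yields an exponent from 0 to r_i - 1; entries of [Rset] start at 1, so 0 is traded
     for r_i. *)
  case: m => [|m] in ltm cm.
    exists (Ordinal (lt_max _ (leqnn _))); rewrite /= order_gt0 leqnn cm.
    by rewrite expg_order expg0 eqxx.
  by exists (Ordinal (lt_max _ (ltnW ltm))); rewrite /= cm eqxx ltnW.
pose v : multi xi := [ffun i => xchoose (c_exp i)].
case/negP: (negbT (noexp v)); apply/andP; split.
  by rewrite inE; apply/forallP => i; rewrite ffunE; case/andP: (xchooseP (c_exp i)).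
rewrite ec; apply/eqP/eq_bigr => i _.
by rewrite ffunE; case/andP: (xchooseP (c_exp i)) => _ /eqP.
Qed.

Lemma prod_order : (\prod_i #[xi i]%g)%N = #|gT|.
Proof. by rewrite -cardsT -(bigdprod_card (G := [group of setT]) dxi). Qed.

Lemma omega_mod i (a b s : nat) : (a = b %[mod #[xi i]%g])%N ->
  omega R #[xi i]%g ^+ (s * a) = omega R #[xi i]%g ^+ (s * b).
Proof.
move=> eab; have w := omega_prim R (order_gt0 (xi i)).
by rewrite -(prim_expr_mod w) -modnMmr eab modnMmr (prim_expr_mod w).
Qed.

Lemma prod_galg_in (v : 'I_n -> nat) (a : 'I_n -> C) :
  \prod_i (a i *: (galg_in (xi i ^+ v i)%g : galg C gT)) =
  (\prod_i a i) *: galg_in (\prod_i xi i ^+ v i)%g.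
Proof.
elim: (index_enum _) => [|i s IHs]; first by rewrite !big_nil scale1r.
by rewrite !big_cons IHs galg_inM -scalerA -scalerAl galg_scaleAr.
Qed.

(** Expanding the product gives one term for each vector of [Rset]; every group element is
    represented by exactly one of them, so a single term contributes. *)
Lemma BidemE (s : multi xi) (v : 'I_n -> nat) :
  Bidem R s (\prod_i xi i ^+ v i)%g =
  (#|gT|%:R)^-1 * \prod_i omega R #[xi i]%g ^- (s i * v i).
Proof.
have -> : Bidem R s = \sum_(j in Rset xi)
    (\prod_i ((#[xi i]%g%:R : C)^-1 * omega R #[xi i]%g ^- (s i * j i))) *:
      galg_in (\prod_i xi i ^+ j i)%g.
  pose G i m : galg C gT := ((#[xi i]%g%:R : C)^-1 * omega R #[xi i]%g ^- (s i * m)) *: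
    galg_in (xi i ^+ m)%g.
  transitivity (\prod_i \sum_(1 <= m < #[xi i]%g.+1) G i m).
    apply: eq_bigr => i _; rewrite /Javg scaler_sumr; apply: eq_bigr => m _.
    by rewrite scalerA.
  by rewrite sum_Rset; apply: eq_bigr => j _; rewrite prod_galg_in.
have [Rv ev] := exponentsP (\prod_i xi i ^+ v i)%g.
set w := exponents xi _ in Rv ev.
rewrite sum_ffunE (bigD1 w) //= [X in _ + X]big1 => [|j /andP[Rj njw]].
  rewrite addr0 !ffunE -ev eqxx /GRing.scale /= mulr1.
  rewrite big_split /=; congr (_ * _).
    by rewrite -prod_order natr_prod prodfV.
  (* The given v may lie outside [Rset]; only its residues modulo the orders matter. *)
  by apply: eq_bigr => i _; rewrite (omega_mod _ (prod_expg_inj ev i)).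
rewrite !ffunE; case: eqP => [ej|_]; last by rewrite scaler0.
case/eqP: njw; apply/ffunP => i; apply: val_inj => /=.
have := prod_expg_inj (etrans (esym ej) ev) i.
(* Entries lie in 1..r_i, so it is their predecessors that are reduced residues; congruence then
   forces equality. *)
have modr (u : multi xi) : u \in Rset xi ->
    (u i = (u i).-1.+1 :> nat) /\ ((u i).-1 < #[xi i]%g)%N.
  by rewrite inE => /forallP/(_ i)/andP[u_gt0 leu]; rewrite prednK.
have [-> ltj] := modr _ Rj; have [-> ltw] := modr _ Rv.
move/eqP; rewrite -(addn1 (j i).-1) -(addn1 (w i).-1) eqn_modDr !modn_small //.
by move=> /eqP ->.
Qed.


(** By [BidemE] the coefficient at e is a product of power sums of roots of unity; it vanishes
    unless r_i divides v_i for all i, that is, unless e = 1. *)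
Lemma sum_Bidem : \sum_(s in Rset xi) Bidem R s = 1 :> galg C gT.
Proof.
apply/ffunP => e; have [_ ee] := exponentsP e; set v := exponents xi e in ee.
rewrite sum_ffunE [in LHS]ee; under eq_bigr do rewrite BidemE.
rewrite -mulr_sumr -(sum_Rset (fun i s => omega R #[xi i]%g ^- (s * v i))).
under eq_bigr do rewrite sum_omegaV ?order_gt0 //.
rewrite ffunE; case: eqP => [e1|ne1].
  rewrite (eq_bigr (fun i => #[xi i]%g%:R)) => [|i _].
    by rewrite -natr_prod prod_order mulVf // pnatr_eq0 -lt0n; apply/card_gt0P; exists e.
  rewrite ifT // /dvdn -[X in _ == X](mod0n #[xi i]%g); apply/eqP.
  apply: (@prod_expg_inj (fun i => v i) (fun=> 0%N)).
  by rewrite -ee e1 big1.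
case: (pickP (fun i => ~~ (#[xi i]%g %| v i)%N)) => [i ndv|all_dv].
  by rewrite [X in _ * X](bigD1 i) //= (negbTE ndv) mul0r mulr0.
case: ne1; rewrite ee big1 // => i _; apply/eqP.
by rewrite -order_dvdn; apply: negbFE; apply: all_dv.
Qed.

Lemma galg_inMl (h : gT) (a : galg C gT) g : (galg_in h * a) g = a (h^-1 * g)%g.
Proof.
rewrite ffunE (bigD1 h) //= ffunE eqxx mul1r big1 ?addr0 // => k nkh.
by rewrite ffunE (negbTE nkh) mul0r.
Qed.

(** Left translation by a group element shifts the exponents in [BidemE], so its value under the
    character indexed by s comes out as a factor. *)
Lemma galg_in_prod_Bidem (v : 'I_n -> nat) (s : multi xi) :
  galg_in (\prod_i xi i ^+ v i)%g * Bidem R s =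
  (\prod_i omega R #[xi i]%g ^+ (v i * s i)) *: Bidem R s.
Proof.
apply/ffunP => g; rewrite galg_inMl ffunE /GRing.scale /=.
set h := (\prod_i _)%g.
have [w eg] : exists w : 'I_n -> nat, (h^-1 * g = \prod_i xi i ^+ w i)%g.
  by exists (fun i => exponents xi (h^-1 * g)%g i); apply: (exponentsP _).2.
rewrite -[in RHS](mulKVg h g) eg -prod_expgD !BidemE mulrCA.
congr (_ * _); rewrite -big_split; apply: eq_bigr => i _ /=.
rewrite mulnDr exprD [(v i * _)%N]mulnC invfM mulrA mulfV ?mul1r //.
by rewrite expf_neq0 ?omega_neq0 ?order_gt0.
Qed.

Lemma galg_in_Bidem (h : gT) (s : multi xi) :
  galg_in h * Bidem R s =
  (\prod_i omega R #[xi i]%g ^+ (exponents xi h i * s i)) *: Bidem R s.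
Proof. by rewrite {1}(exponentsP h).2 galg_in_prod_Bidem. Qed.

Lemma avgEE g : avgE R gT g = (#|gT|%:R)^-1.
Proof.
rewrite ffunE sum_ffunE (bigD1 g) //= ffunE eqxx big1 => [|e neg].
  by rewrite addr0 /GRing.scale /= mulr1.
by rewrite ffunE eq_sym (negbTE neg).
Qed.

Lemma galg_in_avgE h : galg_in h * avgE R gT = avgE R gT.
Proof. by apply/ffunP => g; rewrite galg_inMl !avgEE. Qed.

(** The vector left out of [Jset] consists of the orders r_i: it indexes the trivial character, so
    all its coefficients in [BidemE] equal 1 / |G|. *)
Lemma Rset_Jset :
  {s : multi xi | Bidem R s = avgE R gT & Rset xi = s |: Jset xi /\ s \notin Jset xi}.
Proof.
have lt_max i : (#[xi i]%g < (\max_(i < n) #[xi i]%g).+1)%N by rewrite ltnS (leq_bigmax i).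
pose s : multi xi := [ffun i => Ordinal (lt_max i)]; exists s; last split.
- apply/ffunP => g; rewrite {1}(exponentsP g).2 BidemE avgEE big1 ?mulr1 // => i _.
  by rewrite ffunE /= exprM (prim_expr_order (omega_prim R (order_gt0 _))) expr1n invr1.
- apply/setP => j; rewrite !inE; have [->|njs] /= := eqVneq j s.
    by apply/forallP => i; rewrite ffunE /= order_gt0 leqnn.
  rewrite -[LHS]andbT; congr (_ && _); apply/esym; rewrite -negb_forall.
  apply: contra njs => /forallP js; apply/eqP/ffunP => i; apply: val_inj.
  by rewrite ffunE /=; apply/eqP.
- rewrite !inE negb_and; apply/orP; right.
  by rewrite negb_exists; apply/forallP => i; rewrite ffunE negbK /=.
Qed.

(** Some entry s_i differs from r_i, so w = omega^(s_i) is not 1. Since E absorbs [xi i] while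
    [xi i] acts on B_s as w, E B_s = w E B_s. *)
Lemma avgE_Bidem (s : multi xi) : s \in Jset xi -> avgE R gT * Bidem R s = 0.
Proof.
rewrite inE => /andP[Rs /existsP[i si]].
(* The indicator of i serves as exponent vector, the shape that [galg_in_prod_Bidem] expects. *)
have xiE : (\prod_k xi k ^+ (k == i) = xi i)%g.
  rewrite (eq_bigr (fun k => if k == i then xi k else 1%g)) => [|k _].
    by rewrite -big_mkcond big_pred1_eq.
  by case: eqP.
have avgEr : avgE R gT * galg_in (xi i) = avgE R gT.
  apply/ffunP => g; rewrite ffunE (bigD1 (g * (xi i)^-1)%g) //= big1 => [|h nh].
    by rewrite !avgEE [X in _ * X + _]ffunE invMg invgK mulgKV eqxx mulr1 addr0.
  rewrite [X in _ * X]ffunE; case: eqP => [hg|_]; last by rewrite mulr0.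
  by case/eqP: nh; rewrite -hg invMg invgK mulKVg.
have := galg_in_prod_Bidem (fun k => k == i : nat) s.
rewrite xiE (bigD1 i) //= [\prod_(k < n | k != i) _]big1 ?mulr1 => [|k /negbTE->];
  last by rewrite mul0n.
rewrite eqxx mul1n => xiB; set w := omega _ _ ^+ _ in xiB.
have w1 : w != 1.
  rewrite -(prim_order_dvd (omega_prim R (order_gt0 _))); apply: contra si => dv.
  move: Rs; rewrite inE => /forallP/(_ i)/andP[s_gt0 les].
  by rewrite eqn_leq les dvdn_leq.
have : (1 - w) *: (avgE R gT * Bidem R s) = 0.
  by rewrite scalerBl scale1r -{1}avgEr -mulrA xiB galg_scaleAr subrr.
move/eqP; rewrite scaler_eq0 subr_eq0 eq_sym (negbTE w1) /=.
by move/eqP.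
Qed.

(** Acting on B_j by scalars is inherited by f - 1, by its powers and thus by each term of the
    logarithm; the B_j sum to 1, so ln f is the sum of its products with them. *)
Lemma fps_ln_Bidem (f : {fps galg C gT}) (s : multi xi -> {fps C^o}) :
    {in Rset xi, forall j k, f k * Bidem R j = (s j k : C) *: Bidem R j} ->
  fps_ln f = \sum_(j in Rset xi) fps_vec (Bidem R j) (fps_ln (s j)).
Proof.
move=> fB.
have s1B j k : j \in Rset xi ->
    (f - 1) k * Bidem R j = ((s j - 1) k : C) *: Bidem R j.
  move=> Rj; rewrite !fpsB mulrBl fB // scalerBl !fps1; congr (_ - _).
  by case: eqP => _; rewrite ?mul1r ?scale1r // mul0r scale0r.
have f1B j m k : j \in Rset xi ->
    ((f - 1) ^+ m) k * Bidem R j = (((s j - 1) ^+ m) k : C) *: Bidem R j.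
  move=> Rj; elim: m k => [|m IHm] k.
    by rewrite !fps1; case: eqP => _; rewrite ?mul1r ?scale1r // mul0r scale0r.
  rewrite !exprS !fpsM mulr_suml scaler_suml; apply: eq_bigr => i _.
  by rewrite -mulrA IHm galg_scaleAr s1B // scalerA mulrC.
apply/fpsP => k; rewrite fps_sum /=.
rewrite (eq_bigr (fun j => \sum_(1 <= m < k.+1)
  ((-1) ^+ m.-1 / m%:R : C) *: (((f - 1) ^+ m) k * Bidem R j))).
  rewrite exchange_big /=; apply: eq_bigr => m _.
  by rewrite -scaler_sumr -mulr_sumr sum_Bidem mulr1.
move=> j Rj; rewrite scaler_suml; apply: eq_bigr => m _.
by rewrite f1B // scalerA.
Qed.

Lemma fps_ln_avgE_Bidem (f : {fps galg C gT}) (u : {fps C^o})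
    (s : multi xi -> {fps C^o}) :
    (forall k, f k * avgE R gT = (u k : C) *: avgE R gT) ->
    {in Jset xi, forall j k, f k * Bidem R j = (s j k : C) *: Bidem R j} ->
  fps_ln f = fps_vec (avgE R gT) (fps_ln u)
    + \sum_(j in Jset xi) fps_vec (Bidem R j) (fps_ln (s j)).
Proof.
move=> fE fB; have [top Btop [RsetE topJ]] := Rset_Jset.
(* The trivial character gets its own series u, so s is constrained on [Jset] only. *)
pose s' j := if j == top then u else s j.
have s'E : {in Jset xi, s' =1 s}.
  by move=> j Jj; rewrite /s'; case: eqP => // jtop; rewrite jtop (negbTE topJ) in Jj.
rewrite (fps_ln_Bidem (s := s')) => [|j].
  rewrite [LHS](bigD1 top) /=; last by rewrite RsetE setU11.
  rewrite Btop {1}/s' eqxx; apply: (congr1 (+%R _)); apply: eq_big => [j|j].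
    by rewrite RsetE in_setU1; case: eqP => [->|_]; rewrite ?(negbTE topJ) ?andbT.
  rewrite RsetE in_setU1 => /andP[+ /negbTE ntop]; rewrite ntop /= => Jj.
  by rewrite s'E.
rewrite RsetE in_setU1 => /orP[/eqP-> k|Jj k]; last by rewrite s'E // fB.
by rewrite Btop fE /s' eqxx.
Qed.

Lemma fps_extract_avgE_Bidem (u : {fps C^o}) (s : multi xi -> {fps C^o}) (v : 'I_n -> nat) :
  fps_extract (\prod_i xi i ^+ v i)%g
    (fps_vec (avgE R gT) u + \sum_(j in Jset xi) fps_vec (Bidem R j) (s j)) =
  ((#|gT|%:R)^-1 : C) *:
    (u + \sum_(j in Jset xi) (\prod_(i < n) omega R #[xi i]%g ^- (j i * v i)) *: s j).
Proof.
apply/fpsP => d.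
rewrite fpsZ [in RHS]fpsD [in RHS]fps_sum scalerDr scaler_sumr.
rewrite /fps_extract [LHS]/= fps_sum ffunE sum_ffunE; congr (_ + _).
  by rewrite ffunE avgEE /GRing.scale /= mulrC.
apply: eq_bigr => j _; rewrite ffunE BidemE /GRing.scale /=.
by rewrite mulrC mulrA.
Qed.

End Idempotents.

Lemma leq_card_inj (T : finType) (A B : {set T}) (phi : T -> T) :
  injective phi -> {in A, forall x, phi x \in B} -> (#|A| <= #|B|)%N.
Proof.
move=> phi_inj AB; rewrite -(card_imset _ phi_inj).
by apply/subset_leq_card/subsetP => _ /imsetP[x /AB xB ->].
Qed.

(** * Counting the polynomials of degree d in a class *)

Section ClassCounting.
Variables (F : finFieldType) (l : nat) (k : kind).
Hypothesis k_pos : if k is TypeI t then (0 < t)%N else true.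
Local Notation m := (tail_len k).
Local Notation E := (pclass F l k).

Lemma coef_recip (f : {poly F}) i :
  (recip f)`_i = if (i < size f)%N then f`_(size f - i.+1) else 0.
Proof.
suff -> : recip f = \poly_(j < size f) f`_(size f - j.+1) by rewrite coef_poly.
rewrite poly_def /recip (reindex_inj rev_ord_inj) /=; apply: eq_bigr => j _.
by congr (_ *: 'X^_); rewrite -subn1 -subnDA add1n subnSK ?subKn // ltnW.
Qed.

Lemma dvdXnP n (p : {poly F}) :
  reflect (forall i, (i < n)%N -> p`_i = 0) ('X^n %| p).
Proof.
rewrite /dvdp -Pdiv.IdomainMonic.take_poly_modp.
apply: (iffP eqP) => [p0 i ltin|p0].
  by have := coef_take_poly n p i; rewrite p0 coef0 ltin.
by apply/polyP => i; rewrite coef_take_poly coef0; case: ifP => // /p0.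
Qed.

(** By [k_pos], in type I the constant coefficient is among the m prescribed ones, so g(0) = f(0) is
    nonzero; type II only asks for monicity. *)
Lemma admissible_eq0 (f g : {poly F}) : admissible k f -> g \is monic ->
  ((0 < m)%N -> g`_0 = f`_0) -> admissible k g.
Proof.
rewrite /admissible /tail_len => /andP[_]; move: k_pos; case: k => [t|] /= t_gt0 f0 -> // g0.
by rewrite horner_coef0 g0 // -horner_coef0.
Qed.

(** Puts both types in one form: in type II, m = 0 and ['X^0] divides everything. *)
Lemma class_relE (u v : adm_poly F k) : class_rel l u v =
  ('X^(l.+1) %| recip (val u) - recip (val v)) && ('X^m %| val u - val v).
Proof. by rewrite /class_rel /tail_len; case: k u v => // *; rewrite expr0 dvd1p. Qed.

(* The indices of the coefficients of a degree d polynomial determined by its class. *)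
Definition pinned d i := (i < m)%N || (d <= i + l)%N.

(** Reversal sends index i to d - i, so congruence of the reciprocals modulo ['X^(l.+1)] fixes the
    coefficients with d - i <= l. *)
Lemma class_relP d (u v : adm_poly F k) :
    size (val u) = d.+1 -> size (val v) = d.+1 ->
  reflect (forall i, (i <= d)%N -> pinned d i -> (val u)`_i = (val v)`_i)
          (class_rel l u v).
Proof.
move=> su sv.
rewrite class_relE; apply: (iffP andP) => [[/dvdXnP top /dvdXnP bot] i leid|eq_uv].
  case/orP => [ltim|ledi].
    by apply/eqP; rewrite -subr_eq0 -coefB bot.
  have := top (d - i)%N; rewrite ltnS leq_subLR ledi => /(_ isT)/eqP.
  rewrite coefB !coef_recip su sv ltnS leq_subr subSS subKn // subr_eq0.
  by move/eqP.
split; apply/dvdXnP => i lti; rewrite coefB.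
  rewrite !coef_recip su sv ltnS; case: leqP => // leid; rewrite ?subr0 //.
  rewrite subSS eq_uv ?subrr ?leq_subr // /pinned; apply/orP; right.
  by rewrite -leq_subLR subKn.
have [leid|ltdi] := leqP i d; first by rewrite eq_uv ?subrr // /pinned lti.
by rewrite !nth_default ?subrr // ?su ?sv.
Qed.

Definition fibre d (e : E) : {set {poly_d.+1 F}} :=
  [set f in monics F d | poly_class l k (val f) == Some e].

Lemma poly_classP (f : {poly F}) (e : E) :
  reflect (exists2 u : adm_poly F k, val u = f & adm_class l u = e)
          (poly_class l k f == Some e).
Proof.
rewrite /poly_class; apply: (iffP eqP) => [|[u <- <-]].
  by case: insubP => //= u _ uf [ue]; exists u.
by rewrite valK.
Qed.

Lemma fibreP d e (f : {poly_d.+1 F}) :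
  reflect (exists u : adm_poly F k,
            [/\ val u = val f, adm_class l u = e & size (val u) = d.+1])
          (f \in fibre d e).
Proof.
rewrite !inE; apply: (iffP andP) => [[/andP[_ /eqP sf] /poly_classP[u uf ue]]
                           |[u [uf ue su]]].
  by exists u; rewrite uf.
split; last by apply/poly_classP; exists u.
apply/andP; split; last by apply/eqP; apply: etrans su; rewrite uf.
by rewrite -[polyn f]uf; case/andP: (valP u).
Qed.

(** Index d is always pinned, so g is monic of degree d, and admissibility passes through the
    constant coefficient. A nonempty fibre is thus an affine space. *)
Lemma mem_fibre d e (f g : {poly_d.+1 F}) : f \in fibre d e ->
  (g \in fibre d e) = [forall i : 'I_d.+1, pinned d i ==> (g`_i == f`_i)].
Proof.
move=> /fibreP[u [uf ue su]]; apply/fibreP/forallP => [[v [vg ve sv]] i|gf].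
  apply/implyP => pi; rewrite -[val f]uf -[val g]vg; apply/eqP.
  have /(class_relP sv su) : class_rel l v u by apply/adm_classP; rewrite ve.
  by apply=> //; rewrite -ltnS.
have {}gf i : (i <= d)%N -> pinned d i -> (val g)`_i = (val u)`_i.
  rewrite -ltnS => lti; rewrite uf => pi.
  by have /implyP/(_ pi)/eqP := gf (Ordinal lti).
have gd : (val g)`_d = 1.
  rewrite gf /pinned ?leq_addr ?orbT //; case/andP: (valP u) => /monicP.
  by rewrite /lead_coef su.
have sg : size (val g) = d.+1.
  apply/eqP; rewrite eqn_leq size_npoly /= ltnNge; apply/negP => /(nth_default 0) /eqP.
  by rewrite gd oner_eq0.
have ag : admissible k (val g).
  apply: (admissible_eq0 (valP u)) => [|m_gt0]; first by rewrite monicE /lead_coef sg gd.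
  by rewrite gf // /pinned m_gt0.
exists (exist _ (val g) ag); split=> //=.
by rewrite -ue; apply/adm_classP/(@class_relP d).
Qed.

(** Glues the low m coefficients of a representative to its leading ones, moved to degree d. As l +
    m <= d, the two prescribed ranges do not overlap. *)
Lemma fibre_nonempty d e : (0 < l)%N -> (l + m <= d)%N -> exists f, f \in fibre d e.
Proof.
move=> l_gt0 lelmd; elim/pclassW: e => u; have /andP[/monicP lead_u _] := valP u.
(* Strictness, from 0 < l, lets the coefficient of index d come from the reciprocal, so that p is
   monic. *)
have led_m : (m < d)%N by rewrite (leq_trans _ lelmd) // -{1}[m]add0n ltn_add2r.
pose p := \poly_(i < d.+1) if (i < m)%N then (val u)`_i else (recip (val u))`_(d - i).
have pd : p`_d = 1.
  rewrite coef_poly ltnSn ltnNge (ltnW led_m) /= subnn coef_recip.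
  by rewrite size_poly_gt0 adm_neq0 subn1.
have sp : size p = d.+1.
  apply/eqP; rewrite eqn_leq size_poly /= ltnNge; apply/negP => /(nth_default 0) /eqP.
  by rewrite pd oner_eq0.
have p_lo i : (i < m)%N -> p`_i = (val u)`_i.
  by move=> ltim; rewrite coef_poly ltim ltnS (leq_trans (ltnW ltim) (ltnW led_m)).
have ap : admissible k p.
  by apply: (admissible_eq0 (valP u) _ (p_lo 0%N)); rewrite monicE /lead_coef sp pd.
exists (NPoly (eq_leq sp)); apply/fibreP; exists (exist _ p ap); split=> //=.
apply/adm_classP; rewrite class_relE /=; apply/andP; split; apply/dvdXnP => i lti.
  rewrite coefB [in X in X - _]coef_recip sp ltnS subSS.
  have leil : (i <= l)%N by [].
  have leid : (i <= d)%N by rewrite (leq_trans leil) // (leq_trans _ lelmd) // leq_addr.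
  have lemdi : (m <= d - i)%N by rewrite leq_subRL // (leq_trans _ lelmd) // leq_add2r.
  by rewrite leid coef_poly ltnS leq_subr subKn // ltnNge lemdi subrr.
by rewrite coefB p_lo ?subrr.
Qed.

(** Fibres are translates of each other: adding f' - f turns the pinned coefficients of f into those
    of f'. *)
Lemma leq_card_fibre d e e' : (0 < l)%N -> (l + m <= d)%N ->
  (#|fibre d e| <= #|fibre d e'|)%N.
Proof.
move=> l_gt0 lelmd; have [f fe] := fibre_nonempty e l_gt0 lelmd.
have [f' fe'] := fibre_nonempty e' l_gt0 lelmd.
pose phi (g : {poly_d.+1 F}) : {poly_d.+1 F} := g + (f' - f).
have phi_inj : injective phi by move=> g1 g2 /addIr.
apply: (@leq_card_inj _ _ _ phi phi_inj) => g ge; rewrite /phi.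
rewrite (mem_fibre _ fe'); move: ge; rewrite (mem_fibre _ fe) => /forallP ge.
apply/forallP => i; apply/implyP => pi; have /implyP/(_ pi)/eqP gi := ge i.
change ((polyn g + (polyn f' - polyn f))`_i == f'`_i).
by rewrite coefD coefB gi addrC subrK.
Qed.

Lemma card_fibre_const d e e' : (0 < l)%N -> (l + m <= d)%N ->
  #|fibre d e| = #|fibre d e'|.
Proof.
by move=> l_gt0 lelmd; apply/anti_leq/andP; split; apply: leq_card_fibre.
Qed.

(** For d <= l + m every index is pinned, so a fibre has at most one element. The boolean on the
    right is read as 0 or 1. *)
Lemma card_fibre_small d e : (d <= l + m)%N -> #|fibre d e| = (e \in class_set F l k d).
Proof.
move=> ledlm; have -> : (e \in class_set F l k d) = (fibre d e != set0).
  rewrite inE; apply/exists_inP/set0Pn => [[f fd fe]|[f]].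
    by exists f; rewrite inE fd.
  by rewrite inE => /andP[fd fe]; exists f.
case: (set_0Vmem (fibre d e)) => [->|[f fe]]; first by rewrite cards0 eqxx.
have -> : fibre d e = [set f].
  apply/setP => g; rewrite (mem_fibre _ fe) inE.
  apply/forallP/eqP => [gf|-> i]; last first.
    by rewrite eqxx implybT.
  apply/npolyP => i; have [lti|led] := ltnP i d.+1; last by rewrite !big_coef_npoly.
  have /implyP/(_ _)/eqP -> // := gf (Ordinal lti).
  rewrite /pinned /=; case: ltnP => //= lemi.
  by rewrite (leq_trans ledlm) // addnC leq_add2r.
by rewrite cards1; case: eqP => // /setP/(_ f); rewrite !inE eqxx.
Qed.

(** Degree l + m belongs to both ranges: fibres are nonempty there, while a class outside
    [class_set] would have an empty one. *)
Lemma class_set_full d : (0 < l)%N -> d = (l + m)%N -> class_set F l k d = setT.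
Proof.
move=> l_gt0 dE; apply/setP => e; rewrite [RHS]in_setT; apply/negbNE/negP => eN.
have [f fe] := @fibre_nonempty d e l_gt0 (eq_leq (esym dE)).
have := card_fibre_small e (eq_leq dE); rewrite (negbTE eN) => /eqP.
by rewrite cards_eq0 => /eqP/setP/(_ f); rewrite fe in_set0.
Qed.

Lemma card_monics d : #|monics F d| = (#|F| ^ d)%N.
Proof.
rewrite -card_npoly -cardsT.
pose phi (h : {poly_d F}) : {poly_d.+1 F} := npolyp d.+1 ('X^d + val h).
have sphi (h : {poly_d F}) : size ('X^d + val h) = d.+1.
  by rewrite size_polyDl ?size_polyXn // ltnS size_npoly.
have phiE (h : {poly_d F}) : val (phi h) = 'X^d + val h by apply: npolypK; rewrite sphi.
have phi_inj : injective phi.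
  by move=> h1 h2 /(congr1 val); rewrite !phiE => /addrI/val_inj.
rewrite -(card_imset _ phi_inj); apply: eq_card => f.
rewrite inE; apply/andP/imsetP => [[/monicP mf /eqP sf]|[h _ ->]].
  have sh : (size (val f - 'X^d)%R <= d)%N.
    apply/leq_sizeP => i ledi; rewrite coefB coefXn.
    have [->|neid] := eqVneq i d; last first.
      by rewrite nth_default ?subr0 // sf ltn_neqAle eq_sym neid.
    by move: mf; rewrite /lead_coef sf /= => ->; rewrite subrr.
  by exists (NPoly sh); rewrite ?inE //; apply: val_inj; rewrite phiE /= addrC subrK.
split; last by apply/eqP; rewrite -[RHS](sphi h) -phiE.
rewrite -[polyn _]/(val (phi h)) phiE monicE.
by rewrite lead_coefDl ?lead_coefXn // size_polyXn ltnS size_npoly.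
Qed.

Lemma monics0 : monics F 0 = [set npolyp 1 1].
Proof.
have one_in : npolyp 1 1 \in monics F 0.
  by rewrite inE npolypK ?size_poly1 // monic1.
apply/eqP; rewrite eq_sym eqEcard card_monics cards1 andbT.
by apply/subsetP => f; rewrite inE => /eqP ->.
Qed.

Definition adm_monics d : {set {poly_d.+1 F}} :=
  [set f in monics F d | admissible k (val f)].

Lemma in_fibre d e f :
  (f \in fibre d e) = (f \in monics F d) && (poly_class l k (val f) == Some e).
Proof. exact: in_set. Qed.

Lemma sum_card_fibre d : (\sum_(e : E) #|fibre d e|)%N = #|adm_monics d|.
Proof.
under eq_bigr do rewrite -sum1_card big_mkcond.
rewrite exchange_big -sum1_card [RHS]big_mkcond; apply: eq_bigr => f _ /=.
under eq_bigr do rewrite in_fibre.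
rewrite [f \in adm_monics d]in_set; case: (f \in monics F d) => /=; last by rewrite big1.
case: ifP => [af|naf].
  rewrite (bigD1 (adm_class l (exist _ (val f) af))) //= ifT; last first.
    by apply/poly_classP; exists (exist _ (val f) af).
  rewrite big1 // => e ne; case: ifP => // /poly_classP[u uf ue].
  by case/eqP: ne; rewrite -ue; congr adm_class; apply: val_inj.
rewrite big1 // => e _; case: ifP => // /poly_classP[u uf _].
by case/negP: naf; have := valP u; rewrite uf.
Qed.

(** In degree l + m each class contains exactly one polynomial, so the order of the group becomes a
    count of polynomials. *)
Lemma card_pclass : (0 < l)%N -> #|{: E}| = #|adm_monics (l + m)|.
Proof.
move=> l_gt0; rewrite -sum_card_fibre -sum1_card; apply: eq_bigr => e _.
by rewrite card_fibre_small // class_set_full // inE.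
Qed.

(** * The generating function and its logarithm *)

Section GeneratingFunction.
Variable R : realType.
Local Notation C := R[i].

Lemma genFE d : genF R F l k d =
  \sum_(e : E) (#|fibre d e|%:R : C) *: (galg_in e : galg C E).
Proof.
rewrite /= big_mkcond /=.
under [RHS]eq_bigr do rewrite -sum1_card natr_sum scaler_suml big_mkcond.
rewrite exchange_big; apply: eq_bigr => f _ /=.
under [RHS]eq_bigr do rewrite in_fibre scale1r.
rewrite /poly_galg; case: (f \in monics F d); last by rewrite big1.
case: (poly_class l k (val f)) => [e|] /=; last by rewrite big1.
rewrite (bigD1 e) //= eqxx big1 ?addr0 // => e' /negbTE ne.
by rewrite ifF //; apply/eqP => -[ee]; rewrite ee eqxx in ne.
Qed.

Lemma genF0 : genF R F l k 0%N = 1.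
Proof.
rewrite /= monics0 big_set1 npolypK ?size_poly1 // /poly_galg /poly_class.
rewrite (insubT (admissible k) (admissible1 F k)) /=.
by congr galg_in; congr adm_class; apply: val_inj.
Qed.

Lemma fpsXE n i : ((fpsX : {fps C^o}) ^+ n) i = (i == n)%:R.
Proof.
elim: n i => [|n IHn] i; first by rewrite fps1.
rewrite exprS fpsM; case: i => [|i]; first by rewrite big_ord1 mul0r.
rewrite big_ord_recl mul0r add0r big_ord_recl /= mul1r big1 ?addr0 => [|j _].
  by rewrite IHn subSS subn0 eqSS.
by rewrite mul0r.
Qed.



Lemma class_mulC (e1 e2 : E) : commute e1 e2.
Proof.
by move: e1 e2; elim/pclassW => u; elim/pclassW => v; rewrite /commute -!adm_classM admMC.
Qed.

(** The scalar series by which F acts on E, that is, its image under the trivial character. *)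
Definition adm_series : {fps C^o} := Fps (fun d => #|adm_monics d|%:R : C).

Section Decomposition.
Variables (n : nat) (xi : 'I_n -> E).
Hypothesis l_gt0 : (0 < l)%N.
Hypothesis dxi : (\big[dprod/1]_(i < n) <[xi i]> = [set: E])%g.

Lemma PseriesE (j : multi xi) d : Pseries R j d =
  (d == 0%N)%:R + if (0 < d <= tau l k)%N then char_sum R (class_set F l k d) j else 0.
Proof.
rewrite fpsD fps1 fps_sum; congr (_ + _).
under eq_bigr do rewrite fpsZ fpsXE.
case: ifP => [/andP[d_gt0 led]|ndtau].
  rewrite (bigD1_seq d) ?mem_index_iota ?ltnS ?d_gt0 ?iota_uniq //= eqxx.
  rewrite big1 => [|i /negbTE ne]; first by rewrite addr0 /GRing.scale /= mulr1.
  by rewrite eq_sym ne scaler0.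
rewrite big_nat big1 // => i; rewrite ltnS => lei.
by case: eqP => [di|_]; rewrite ?scaler0 //; rewrite di lei in ndtau.
Qed.

(** Positivity makes the truncated subtraction in [tau] exact; P_j thus stops just before degree l +
    m, from which on all fibres have equal size. *)
Lemma tauS : (tau l k).+1 = (l + m)%N.
Proof.
rewrite /tau /tail_len; case: k k_pos => [t|] _; last by rewrite addn0 subn1 prednK.
by rewrite subn1 prednK // addn_gt0 l_gt0.
Qed.

Lemma genF_avgE d : genF R F l k d * avgE R E = (adm_series d : C) *: avgE R E.
Proof.
rewrite genFE mulr_suml /= -sum_card_fibre natr_sum scaler_suml.
by apply: eq_bigr => e _; rewrite -scalerAl galg_in_avgE.
Qed.

Lemma genF_Bidem (j : multi xi) : j \in Jset xi -> forall d,
  genF R F l k d * Bidem R j = (Pseries R j d : C) *: Bidem R j.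
Proof.
move=> Jj d; rewrite PseriesE.
have [->|d_gt0] := posnP d; first by rewrite genF0 mul1r addr0 scale1r.
rewrite genFE add0r /= -ltnS tauS; have [ltd|led] := ltnP d.
  (* Below l + m the coefficient of F is the sum of the classes in [class_set], each acting on B_j
     by its character value; these add up to c_(d, j). *)
  rewrite mulr_suml scaler_suml [RHS]big_mkcond; apply: eq_bigr => e _ /=.
  rewrite (card_fibre_small e (ltnW ltd)) -scalerAl (galg_in_Bidem R class_mulC dxi).
  by case: (e \in _); rewrite ?scale1r ?scale0r.
(* From l + m on all fibres have one size N, so the coefficient of F is a multiple of E and is
   killed by B_j. *)
have [N fibreN] : exists N, forall e : E, #|fibre d e| = N.
  by exists #|fibre d (1%g : E)| => e; apply: card_fibre_const.
have -> : \sum_e (#|fibre d e|%:R : C) *: (galg_in e : galg C E) =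
    (N%:R * #|{: E}|%:R) *: avgE R E.
  rewrite /avgE scalerA mulfK; last first.
    by rewrite pnatr_eq0 -lt0n; apply/card_gt0P; exists 1%g.
  by rewrite scaler_sumr; apply: eq_bigr => e _; rewrite fibreN.
by rewrite scale0r -scalerAl (avgE_Bidem R class_mulC dxi Jj) scaler0.
Qed.

Lemma ln_genF : fps_ln (genF R F l k) =
  fps_vec (avgE R E) (fps_ln adm_series)
  + \sum_(j in Jset xi) fps_vec (Bidem R j) (fps_ln (Pseries R j)).
Proof.
exact: (fps_ln_avgE_Bidem dxi genF_avgE genF_Bidem).
Qed.

Lemma extract_ln_genF (tt : 'I_n -> nat) :
  fps_extract (\prod_(i < n) xi i ^+ tt i)%g (fps_ln (genF R F l k)) =
  (#|{: E}|%:R^-1 : C) *: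
    (fps_ln adm_series
     + \sum_(j in Jset xi)
         (\prod_(i < n) omega R #[xi i]%g ^- (j i * tt i)) *: fps_ln (Pseries R j)).
Proof.
rewrite ln_genF.
exact: (fps_extract_avgE_Bidem dxi _ (fun j => fps_ln (Pseries R j))).
Qed.

End Decomposition.

End GeneratingFunction.

End ClassCounting.

(** * Quotients by 1 - q z *)

Section RationalSeries.
Variable (R : realType).
Local Notation C := R[i].

(** The recurrence says that f (1 - q z) = a, coefficient by coefficient. *)
Lemma fps_eq_div (f a : {fps C^o}) (q : C) :
    f 0%N = a 0%N -> (forall d, f d.+1 = q * f d + a d.+1) ->
  f = a / (1 - q *: fpsX).
Proof.
move=> f0 fS; have b0 : (1 - q *: fpsX : {fps C^o}) 0%N = 1.
  by rewrite fpsB fpsZ fps1 scaler0 subr0.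
have ub : (1 - q *: fpsX : {fps C^o}) \is a GRing.unit.
  (* A series is by definition a unit when its constant term is one. *)
  change (is_true ((1 - q *: fpsX : {fps C^o}) 0%N \is a GRing.unit)).
  by rewrite b0 unitr1.
apply: (canRL (mulrK ub)); apply/fpsP => d; rewrite mulrC mulrBl mul1r fpsB fpsM.
case: d => [|d]; first by rewrite big_ord1 fpsZ scaler0 mul0r subr0.
rewrite big_ord_recl fpsZ scaler0 mul0r add0r big_ord_recl /= big1 => [|i _].
  have -> : q *: (1 : C^o) = q by apply: mulr1.
  by rewrite addr0 fS /bump /= subSS subn0 addrC addKr.
by rewrite scaler0 mul0r.
Qed.

End RationalSeries.

(** * Admissible polynomials counted by degree *)

Section AdmissibleCounts.
Variables (R : realType) (F : finFieldType).
Local Notation C := R[i].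

Lemma card_adm_monicsII d : #|adm_monics F TypeII d| = (#|F| ^ d)%N.
Proof.
rewrite -card_monics; apply: eq_card => f; rewrite [LHS]in_set.
by apply: andb_idr; rewrite inE /admissible andbT => /andP[].
Qed.

Lemma adm_seriesII : adm_series F TypeII R = (1 - (#|F|%:R : C) *: fpsX)^-1.
Proof.
rewrite -[RHS]mul1r; apply: fps_eq_div => [|d].
  by rewrite /= card_adm_monicsII.
by rewrite /= !card_adm_monicsII expnS natrM addr0.
Qed.

Variable t : nat.

Lemma card_adm_monicsI0 : #|adm_monics F (TypeI t) 0| = 1%N.
Proof.
rewrite -[RHS](cards1 (npolyp 1 (1 : {poly F}))) -monics0; apply: eq_card => f.
rewrite in_set; apply/andP/idP => [[]//|f1]; split=> //.
move: f1; rewrite monics0 inE => /eqP ->.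
have -> : val (npolyp 1 (1 : {poly F})) = 1 by apply: npolypK; rewrite size_poly1.
exact: admissible1.
Qed.

(* The monic f of degree d + 1 with f(0) = 0 are the x g with g monic of degree d. *)
Lemma card_adm_monicsI d :
  #|adm_monics F (TypeI t) d.+1| = ((#|F| - 1) * #|F| ^ d)%N.
Proof.
pose phi (g : {poly_d.+1 F}) : {poly_d.+2 F} := npolyp d.+2 (val g * 'X).
have phiE (g : {poly_d.+1 F}) : val (phi g) = val g * 'X.
  apply: npolypK; rewrite (leq_trans (size_polyMleq _ _)) //.
  by rewrite size_polyX addn2 ltnS size_npoly.
have phi_inj : injective phi.
  move=> g1 g2 /(congr1 val); rewrite !phiE => /mulIf; rewrite polyX_eq0.
  by move=> /(_ isT)/val_inj.
have monM : monics F d.+1 :\: adm_monics F (TypeI t) d.+1 = phi @: monics F d.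
  apply/setP => f; apply/setDP/imsetP => [[fd]|[g]].
    rewrite in_set fd /=; move: fd; rewrite inE => /andP[mf /eqP sf].
    rewrite /admissible mf /= negbK => /factor_theorem[p].
    rewrite polyC0 subr0 => fE.
    have p0 : p != 0.
      apply: contraTneq mf => p0.
      by rewrite fE p0 mul0r monicE lead_coef0 eq_sym oner_eq0.
    have sp : size p = d.+1 by move: sf; rewrite fE size_mulX // => -[].
    exists (NPoly (eq_leq sp)); last by apply: val_inj; rewrite phiE.
    by rewrite inE /= sp eqxx andbT; move: mf; rewrite fE monicMr ?monicX.
  rewrite inE => /andP[mg /eqP sg ->].
  have mphi : val (phi g) \is monic by rewrite phiE rpredM ?monicX.
  split; last first.
    by rewrite in_set negb_and /admissible mphi phiE hornerMX mulr0 eqxx orbT.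
  rewrite inE; apply/andP; split=> //.
  apply/eqP; rewrite -[polyn _]/(val (phi g)) phiE size_mulX ?sg //.
  exact: monic_neq0.
have := cardsID (adm_monics F (TypeI t) d.+1) (monics F d.+1).
rewrite monM card_imset // !card_monics (setIidPr _).
  by move=> cE; rewrite mulnBl mul1n -expnS -cE addnK.
by apply/subsetP => f; rewrite in_set => /andP[].
Qed.

(** The counts are 1, q - 1, (q - 1) q, ...; the recurrence with ratio q fails only at degree 1, by
    -1, whence the numerator 1 - z. *)
Lemma adm_seriesI :
  adm_series F (TypeI t) R = (1 - fpsX) / (1 - (#|F|%:R : C) *: fpsX).
Proof.
have q_gt0 : (0 < #|F|)%N by apply/card_gt0P; exists 0.
apply: fps_eq_div => [|[|d]] /=.
- by rewrite card_adm_monicsI0 oppr0 addr0.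
- rewrite card_adm_monicsI card_adm_monicsI0 mulr1 muln1 natrB //=.
  by rewrite sub0r.
- by rewrite !card_adm_monicsI subr0 addr0 expnS mulnCA natrM.
Qed.

End AdmissibleCounts.

Theorem theorem1 (R : realType) (F : finFieldType) (l t : nat)
    (hl : (0 < l)%N) (ht : (0 < t)%N) :
  let q : R[i] := #|F|%:R in
  (forall (n : nat) (xi : 'I_n -> pclass F l (TypeI t)),
    (\big[dprod/1]_(i < n) <[xi i]> = [set: pclass F l (TypeI t)])%g ->
    let lnF := fps_ln (genF R F l (TypeI t)) in
    lnF = fps_vec (avgE R _) (fps_ln ((1 - fpsX) / (1 - q *: fpsX)))
          + \sum_(j in Jset xi) fps_vec (Bidem R j) (fps_ln (Pseries R j))
    /\
    forall tt : 'I_n -> nat,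
      fps_extract (\prod_(i < n) xi i ^+ tt i)%g lnF =
      ((q - 1)^-1 * q ^ (1 - l%:Z - t%:Z)) *:
        (fps_ln ((1 - fpsX) / (1 - q *: fpsX))
         + \sum_(j in Jset xi)
             (\prod_(i < n) omega R #[xi i]%g ^- (j i * tt i)) *:
               fps_ln (Pseries R j)))
  /\
  (forall (n : nat) (xi : 'I_n -> pclass F l TypeII),
    (\big[dprod/1]_(i < n) <[xi i]> = [set: pclass F l TypeII])%g ->
    let lnF := fps_ln (genF R F l TypeII) in
    lnF = fps_vec (avgE R _) (fps_ln (1 - q *: fpsX)^-1)
          + \sum_(j in Jset xi) fps_vec (Bidem R j) (fps_ln (Pseries R j))
    /\
    forall tt : 'I_n -> nat,
      fps_extract (\prod_(i < n) xi i ^+ tt i)%g lnF =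
      q ^ (- l%:Z) *:
        (fps_ln (1 - q *: fpsX)^-1
         + \sum_(j in Jset xi)
             (\prod_(i < n) omega R #[xi i]%g ^- (j i * tt i)) *:
               fps_ln (Pseries R j))).
Proof.
move=> q; have q_gt0 : (0 < #|F|)%N by apply/card_gt0P; exists 0.
split=> n xi dxi lnF.
  split=> [|tt]; first by rewrite /lnF (@ln_genF F l (TypeI t) ht R n xi hl dxi) adm_seriesI.
  rewrite /lnF (@extract_ln_genF F l (TypeI t) ht R n xi hl dxi) adm_seriesI; congr (_ *: _).
  rewrite (@card_pclass F l (TypeI t) ht hl) /=.
  (* The successor form matches [card_adm_monicsI]: the group has order (q - 1) q^(l + t - 1). *)
  have -> : (l + t = (l + t - 1).+1)%N by rewrite subn1 prednK // addn_gt0 hl.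
  rewrite card_adm_monicsI natrM natrB // invfM natrX exprnN; congr (_ * q ^ _).
  by rewrite -subzn ?addn_gt0 ?hl // PoszD !opprB opprD addrA.
split=> [|tt]; first by rewrite /lnF (@ln_genF F l TypeII isT R n xi hl dxi) adm_seriesII.
rewrite /lnF (@extract_ln_genF F l TypeII isT R n xi hl dxi) adm_seriesII; congr (_ *: _).
(* Here m = 0, so the group has order q^l. *)
by rewrite (@card_pclass F l TypeII isT hl) card_adm_monicsII addn0 natrX exprnN.
Qed.
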